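(* Let $X$ be a real Hilbert space, let $\Gamma\subseteq\mathbb{R}_{++}$ be nonempty, let $(T_\gamma)_{\gamma\in\Gamma}$ be a family of nonexpansive operators on $X$ such that $\operatorname{Fix}T_\gamma\neq\varnothing$ for every $\gamma\in\Gamma$, and let $(Q_{\delta\gets\gamma})_{\gamma,\delta\in\Gamma}$ be operators on $X$ that are fixed-point relocators for $(T_\gamma)_{\gamma\in\Gamma}$ with Lipschitz constants $(\mathcal{L}_{\delta\gets\gamma})_{\gamma,\delta\in\Gamma}$ in $[1,+\infty[$. Let $(\gamma_n)_{n\in\mathbb{N}}$ be a sequence in $\Gamma$ that converges to some $\overline{\gamma}\in\Gamma$ and satisfies $$\sum_{n\in\mathbb{N}}\bigl(\mathcal{L}_{\gamma_{n+1}\gets\gamma_n}-1\bigr)<+\infty .$$ Let $x_0\in X$ and generate $(x_n)_{n\in\mathbb{N}}$ by $$(\forall n\in\mathbb{N})\quad x_{n+1}:=Q_{\gamma_{n+1}\gets\gamma_n}T_{\gamma_n}x_n .$$ Then the following hold. (i) The sequence $(x_n)_{n\in\mathbb{N}}$ is Opial with respect to $\operatorname{Fix}T_{\overline{\gamma}}$. (ii) If there exists $\alpha\in\left]0,1\right[$ such that $T_\gamma$ is $\alpha$-averaged for every $\gamma\in\Gamma$, then $x_n-T_{\gamma_n}x_n\to0$. (iii) If there exists $\alpha\in\left]0,1\right[$ such that $T_\gamma$ is $\alpha$-averaged for every $\gamma\in\Gamma$, and if moreover the map $X\times\Gamma\to X\colon(x,\gamma)\mapsto T_\gamma x$ is continuous,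 then both $(x_n)_{n\in\mathbb{N}}$ and $(T_{\gamma_n}x_n)_{n\in\mathbb{N}}$ converge weakly to the same point in $\operatorname{Fix}T_{\overline{\gamma}}$.
   Context: $\mathbb{R}_{++}$ is the set of positive real numbers. $\operatorname{Fix}T=\{x\in X: Tx=x\}$. Convergence $\to$ is in norm; continuity is with respect to the norm topology of $X$. An operator $T\colon X\to X$ is nonexpansive if $\|Tx-Ty\|\le\|x-y\|$ for all $x,y\in X$; it is $\alpha$-averaged, with $\alpha\in\left]0,1\right[$, if $\|Tx-Ty\|^2+\frac{1-\alpha}{\alpha}\|(\mathrm{Id}-T)x-(\mathrm{Id}-T)y\|^2\le\|x-y\|^2$ for all $x,y\in X$. Fixed-point relocators: given a nonempty set $\Gamma\subseteq\mathbb{R}_{++}$ and a family $(T_\gamma)_{\gamma\in\Gamma}$ of operators from $X$ to $X$, a family of operators $(Q_{\delta\gets\gamma})_{\gamma,\delta\in\Gamma}$ on $X$ defines fixed-point relocators for $(T_\gamma)_{\gamma\in\Gamma}$ with Lipschitz constants $(\mathcal{L}_{\delta\gets\gamma})_{\gamma,\delta\in\Gamma}$ in $[1,+\infty[$ if: (a) for all $\gamma,\delta\in\Gamma$, $Q_{\delta\gets\gamma}|_{\operatorname{Fix}T_\gamma}$ is a bijection from $\operatorname{Fix}T_\gamma$ to $\operatorname{Fix}T_\delta$; (b) for all $\gamma\in\Gamma$ and $x\in\operatorname{Fix}T_\gamma$, the map $\Gamma\to X\colon\delta\mapsto Q_{\delta\gets\gamma}x$ is continuous; (c) for all $\gamma,\delta,\varepsilon\in\Gamma$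 and $x\in\operatorname{Fix}T_\gamma$, $Q_{\varepsilon\gets\delta}Q_{\delta\gets\gamma}x=Q_{\varepsilon\gets\gamma}x$; (d) for all $\gamma,\delta\in\Gamma$, $Q_{\delta\gets\gamma}$ is $\mathcal{L}_{\delta\gets\gamma}$-Lipschitz continuous. A sequence $(x_n)_{n\in\mathbb{N}}$ in $X$ is Opial with respect to a nonempty set $C\subseteq X$ if $\lim_{n\to\infty}\|x_n-c\|$ exists for every $c\in C$. *)

(* Defs.v *)
From HB Require Import structures.
From mathcomp Require Import all_boot all_order all_algebra.
From mathcomp Require Import all_classical all_reals all_analysis.

Set Implicit Arguments.
Unset Strict Implicit.
Unset Printing Implicit Defensive.

Import Order.TTheory GRing.Theory Num.Theory.
Import numFieldNormedType.Exports.

Local Open Scope classical_set_scope.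
Local Open Scope ring_scope.

(* A real Hilbert space is a complete normed module over a realType together
   with a symmetric positive definite bilinear form, of type {dot X for idfun},
   that induces the norm. *)
Definition induces_norm (R : realType) (X : normedModType R)
    (ip : {dot X for (idfun : R -> R)}) :=
  forall x : X, `|x| ^+ 2 = ip x x.

Definition Fix (X : Type) (T : X -> X) : set X := [set x | T x = x].

Definition nonexpansive (R : realType) (X : normedModType R) (T : X -> X) :=
  forall x y : X, `|T x - T y| <= `|x - y|.

Definition averaged (R : realType) (X : normedModType R) (alpha : R)
    (T : X -> X) :=
  forall x y : X,
    `|T x - T y| ^+ 2 +
      (1 - alpha) / alpha * `|(x - T x) - (y - T y)| ^+ 2
    <= `|x - y| ^+ 2.

(* Families indexed by Gamma are total functions on R whose values outside
   Gamma are irrelevant.  The operator from gamma to delta is Q delta gamma,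
   target index first, and likewise for its Lipschitz constant. *)
Record relocators (R : realType) (X : normedModType R) (Gamma : set R)
    (T : R -> X -> X) (Q : R -> R -> X -> X) (L : R -> R -> R) : Prop := {
  relocators_constant_ge1 : forall gamma delta,
    Gamma gamma -> Gamma delta -> 1 <= L delta gamma;
  relocators_bij : forall gamma delta,
    Gamma gamma -> Gamma delta ->
    set_bij (Fix (T gamma)) (Fix (T delta)) (Q delta gamma);
  relocators_continuous : forall gamma x,
    Gamma gamma -> Fix (T gamma) x ->
    {within Gamma, continuous (fun delta => Q delta gamma x)};
  relocators_comp : forall gamma delta epsilon x,
    Gamma gamma -> Gamma delta -> Gamma epsilon -> Fix (T gamma) x ->
    Q epsilon delta (Q delta gamma x) = Q epsilon gamma x;
  relocators_lipschitz : forall gamma delta,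
    Gamma gamma -> Gamma delta -> (L delta gamma).-lipschitz (Q delta gamma)
}.

Definition Opial (R : realType) (X : normedModType R) (C : set X)
    (x : nat -> X) :=
  C !=set0 /\ forall c, C c -> cvg (`|x n - c| @[n --> \oo]).

(* The scalars are seen as R^o, the field as a normed module over itself. *)
Definition weakly_cvg (R : realType) (X : normedModType R) (x : nat -> X)
    (l : X) :=
  forall f : {linear X -> R^o}, continuous f -> f (x n) @[n --> \oo] --> f l.

(* Main.v *)
Require Import Defs.
From HB Require Import structures.
From mathcomp Require Import all_boot all_order all_algebra.
From mathcomp Require Import all_classical all_reals all_analysis.
From mathcomp Require Import ring lra.

Set Implicit Arguments.
Unset Strict Implicit.
Unset Printing Implicit Defensive.

Import Order.TTheory GRing.Theory Num.Theory.
Import numFieldNormedType.Exports.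

Local Open Scope classical_set_scope.
Local Open Scope ring_scope.

(** Transport a fixed point [c] of [T gbar] along the relocators: the moving
    target [c_ n := Q (g n) gbar c] is fixed by [T (g n)], the composition rule
    gives [Q (g n.+1) (g n) (c_ n) = c_ n.+1], and continuity in the parameter
    gives [c_ n --> c].  As [T (g n)] is nonexpansive and [Q (g n.+1) (g n)] is
    Lipschitz, the distances [a n := `|x n - c_ n|] satisfy
    [a n.+1 <= L (g n.+1) (g n) * a n].  Since the excesses
    [L (g n.+1) (g n) - 1] are summable, [a] converges
    ([is_cvg_almost_nonincreasing]), hence so does [`|x n - c|]: this is the
    Opial property.

    If the operators are averaged, the step from [x n] to [T (g n) (x n)] loses
    a multiple of [`|x n - T (g n) (x n)| ^+ 2] of squared distance to [c_ n].
    The loss is at most [a n ^+ 2 - (a n.+1 / L (g n.+1) (g n)) ^+ 2], which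
    tends to [0] because [a] converges and the Lipschitz constants tend to [1].
    Hence [x n - T (g n) (x n) --> 0].

    For weak convergence, weak cluster points are taken to be vectors [z] such
    that every [ip (x n) y] tends to [ip z y] along some ultrafilter on the
    indices, the same for all [y].  They exist because a bounded real family has a
    limit along any ultrafilter and the limits, as a function of [y], form a
    bounded linear functional, which is represented by a vector
    ([weak_ultralimit], from [riesz]).  By demiclosedness
    ([demiclosed_nonexpansive]) every one of them is a fixed point of [T gbar].
    Opial's argument ([Opial_cvg]) then shows that all of them coincide, and a
    sequence with the same limit along every nonprincipal ultrafilter
    converges. *)

(** * Almost nonincreasing real sequences *)

(** The factors are absorbed by an exponential: as [1 + t <= expR t], the
    sequence [a n * expR (- series e n)] is nonincreasing, and multiplying back
    by the convergent [expR (series e n)] recovers [a]. *)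
Lemma is_cvg_almost_nonincreasing (R : realType) (e a : nat -> R) :
  (forall n, 0 <= e n) -> cvgn (series e) ->
  (forall n, 0 <= a n) -> (forall n, a n.+1 <= (1 + e n) * a n) ->
  cvgn a.
Proof.
move=> e_ge0 cvg_e a_ge0 a_le.
pose u n := a n * expR (- series e n).
have u_decr : nonincreasing_seq u.
  apply/nonincreasing_seqP => n; rewrite /u seriesSr opprD expRD.
  rewrite [leLHS]mulrA mulrAC ler_wpM2r ?expR_ge0//.
  rewrite expRN ler_pdivrMr ?expR_gt0//.
  by rewrite (le_trans (a_le n))// mulrC ler_wpM2l// expR_ge1Dx.
have cvg_u : cvgn u.
  apply: nonincreasing_is_cvgn => //.
  exists (0 : R) => _ [n _ <-].
  by rewrite mulr_ge0 ?expR_ge0.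
have -> : a = u \* (expR \o series e).
  by apply/funext => n; rewrite /u /= -mulrA -expRD addNr expR0 mulr1.
apply: is_cvgM => //.
by apply/cvg_ex; exists (expR (limn (series e))); apply: continuous_cvg => //;
  exact: continuous_expR.
Qed.

Lemma is_cvg_series_of_nneseries_lty (R : realType) (e : nat -> R) :
  (forall n, 0 <= e n) -> (\sum_(0 <= n <oo) (e n)%:E < +oo)%E ->
  cvgn (series e).
Proof.
move=> e_ge0 sum_lty.
have sum_ge0 : (0 <= \sum_(0 <= n <oo) (e n)%:E)%E.
  by apply: nneseries_ge0 => n _ _; rewrite lee_fin.
apply: nondecreasing_is_cvgn; first exact: nondecreasing_series.
exists (fine (\sum_(0 <= n <oo) (e n)%:E)) => _ [n _ <-].
rewrite -lee_fin fineK ?ge0_fin_numE// /series /= -sumEFin.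
by apply: nneseries_lim_ge => k _; rewrite lee_fin.
Qed.

(** * Inner product and norm *)

Lemma dotC (R : realType) (X : normedModType R)
    (ip : {dot X for (idfun : R -> R)}) (u v : X) :
  ip u v = ip v u.
Proof. by rewrite hermC expr0 mul1r. Qed.

Lemma sqr_normD (R : realType) (X : normedModType R)
    (ip : {dot X for (idfun : R -> R)})
    (hip : induces_norm ip) (u v : X) :
  `|u + v| ^+ 2 = `|u| ^+ 2 + 2 * ip u v + `|v| ^+ 2.
Proof. by rewrite !hip hnormD /= expr0 mul1r; ring. Qed.

Lemma sqr_normB (R : realType) (X : normedModType R)
    (ip : {dot X for (idfun : R -> R)})
    (hip : induces_norm ip) (u v : X) :
  `|u - v| ^+ 2 = `|u| ^+ 2 - 2 * ip u v + `|v| ^+ 2.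
Proof. by rewrite !hip hnormB /= expr0 mul1r; ring. Qed.

(** Cauchy-Schwarz, by expanding the square of [`|v| ^+ 2 *: u - ip u v *: v],
    a multiple of the component of [u] orthogonal to [v]. *)
Lemma dot_le_norm (R : realType) (X : normedModType R)
    (ip : {dot X for (idfun : R -> R)})
    (hip : induces_norm ip) (u v : X) :
  `|ip u v| <= `|u| * `|v|.
Proof.
have [->|v0] := eqVneq v 0; first by rewrite linear0r !normr0 mulr0.
have v_gt0 : 0 < `|v| ^+ 2 by rewrite exprn_gt0// normr_gt0.
rewrite -ler_sqr ?nnegrE ?mulr_ge0// real_normK ?num_real// exprMn.
have : 0 <= `| `|v| ^+ 2 *: u - ip u v *: v| ^+ 2 by rewrite exprn_ge0.
rewrite (sqr_normB hip) !normrZ !exprMn !real_normK ?num_real//.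
have -> : ip (`|v| ^+ 2 *: u) (ip u v *: v) = `|v| ^+ 2 * (ip u v * ip u v).
  by rewrite linearZl_LR linearZr_LR.
by move=> h; rewrite -subr_ge0 -(pmulr_rge0 _ v_gt0); lra.
Qed.

(** * Riesz representation and weak limits along ultrafilters *)

(** The representing vector minimises [E v := `|v| ^+ 2 - 2 * f v]:
    if [f = ip z], then [E v = `|v - z| ^+ 2 - `|z| ^+ 2].  By the parallelogram law
    minimising sequences are Cauchy, so a minimiser exists by completeness, and
    the derivative of [E] vanishes there in every direction. *)
Lemma riesz (R : realType) (X : completeNormedModType R)
    (ip : {dot X for (idfun : R -> R)}) (f : {linear X -> R^o}) :
  induces_norm ip -> continuous f -> exists z, forall y, f y = ip z y.
Proof.
move=> hip f_cont.
have fD u w : f (u + w) = f u + f w :> R by exact: linearD.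
have fZ a u : f (a *: u) = a * f u :> R by exact: linearZ.
pose E v : R := `|v| ^+ 2 - 2 * f v.
have [M f_le] : exists M : R, forall v, `|f v| <= M * `|v|.
  have /linear_bounded_continuous/linear_boundedP/pinfty_ex_gt0 := f_cont.
  by move=> [M _ f_le]; exists M.
have E_lb : lbound (range E) (- M ^+ 2).
  move=> _ [v _ <-]; rewrite /E.
  have := f_le v; rewrite ler_norml => /andP[_ fv_le].
  by have := sqr_ge0 (`|v| - M); lra.
have E_inf : has_inf (range E).
  by split; [exists (E 0), 0 | exists (- M ^+ 2)].
pose m := inf (range E).
have E_ge v : m <= E v by apply: ge_inf; [exact: E_inf.2|exists v].
have /choice[v Ev_lt] : forall n : nat, exists v, E v < m + n.+1%:R^-1.
  move=> n.
  have [|_ [w _ <-] w_lt] := @inf_adherent _ (range E) n.+1%:R^-1 _ E_inf.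
    by rewrite invr_gt0.
  by exists w.
(* The parallelogram law, where [E] is at least [m] at the midpoint. *)
have close u w : `|u - w| ^+ 2 <= 2 * (E u - m) + 2 * (E w - m).
  have := E_ge (2^-1 *: (u + w)).
  rewrite /E normrZ exprMn fZ fD (sqr_normD hip) (sqr_normB hip).
  by rewrite ger0_norm//; lra.
have v_cvg : cvgn v.
  apply/cauchy_cvgP/cauchy_exP => e e_gt0.
  have e2_gt0 : 0 < e ^+ 2 / 4 by rewrite divr_gt0// exprn_gt0.
  have [N _ N_lt] := near_infty_natSinv_lt (PosNum e2_gt0).
  have E_lt n : (N <= n)%N -> E (v n) - m < e ^+ 2 / 4.
    by move=> Nn; rewrite ltrBlDl (lt_trans (Ev_lt n))// ltrD2l; exact: N_lt.
  exists (v N); exists N => // n Nn; rewrite /= -ball_normE/=.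
  rewrite -ltr_sqr ?nnegrE// ?(ltW e_gt0)// (le_lt_trans (close _ _))//.
  by have := E_lt N (leqnn N); have := E_lt n Nn; lra.
pose z := limn v.
have Ez_le : E z <= m.
  have cvg_E : E \o v @ \oo --> E z.
    apply: cvgB; first by apply: cvgM; exact: cvg_norm.
    by apply: cvgMl_tmp; apply: (cvg_comp _ _ v_cvg); exact: f_cont.
  have cvg_m : m + n.+1%:R^-1 @[n --> \oo] --> m.
    by rewrite -[X in _ --> X]addr0; apply: cvgD;
      [exact: cvg_cst | exact: cvg_harmonic].
  by apply: (ler_cvg_to cvg_E cvg_m); apply: nearW => n; exact/ltW/Ev_lt.
exists z => y; apply/eqP; rewrite -subr_eq0; apply/eqP.
(* Compare [E] at [z] and at [z + t *: y].  The optimal step is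
   [t = d / `|y| ^+ 2]; adding [1] to the denominator allows [y = 0]. *)
set d := f y - ip z y; pose N := `|y| ^+ 2.
have N_ge0 : 0 <= N by rewrite exprn_ge0.
have := le_trans Ez_le (E_ge (z + (d / (N + 1)) *: y)).
rewrite /E (sqr_normD hip) normrZ exprMn fD fZ linearZr_LR /=.
rewrite real_normK ?num_real// -/N => h.
have : 0 <= (d / (N + 1)) ^+ 2 * N - 2 * (d / (N + 1)) * d.
  by rewrite /d; rewrite /d in h; lra.
have -> : (d / (N + 1)) ^+ 2 * N - 2 * (d / (N + 1)) * d =
    - ((N + 2) * (d / (N + 1)) ^+ 2) by field; lra.
rewrite oppr_ge0 pmulr_rle0; last by lra.
rewrite real_exprn_even_le0 ?num_real//= mulf_eq0 invr_eq0.
by case/orP => /eqP; lra.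
Qed.

(** A cluster point exists by compactness of segments; the ultrafilter contains
    either the preimage of a given neighbourhood of it or the complement, and
    the complement would contradict clustering. *)
Lemma ultra_cvg_bounded (R : realType) (I : Type) (U : set_system I)
    (u : I -> R) (M : R) :
  UltraFilter U -> (forall i, `|u i| <= M) ->
  exists l : R, u i @[i --> U] --> l.
Proof.
move=> UU u_le.
have [|l [_ l_cluster]] := @segment_compact R (- M) M (u @ U) _.
  apply: (@filterS _ U _ setT) => [i _ /=|]; last exact: filterT.
  by rewrite in_itv /= -ler_norml.
exists l => B /= Bl.
have [//|UB] := in_ultra_setVsetC (u @^-1` B) UU.
by have [y [/= nBy By]] := l_cluster (~` B) B UB Bl.
Qed.

(** Bounded families are relatively weakly compact: the scalar limits of
    [ip (x i) y] depend linearly and boundedly on [y], so they are of the form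
    [ip z y]. *)
Lemma weak_ultralimit (R : realType) (X : completeNormedModType R)
    (ip : {dot X for (idfun : R -> R)}) (I : Type) (U : set_system I)
    (x : I -> X) (M : R) :
  induces_norm ip -> UltraFilter U -> (forall i, `|x i| <= M) ->
  exists z, forall y, ip (x i) y @[i --> U] --> ip z y.
Proof.
move=> hip UU x_le.
have dot_le y i : `|ip (x i) y| <= M * `|y|.
  by rewrite (le_trans (dot_le_norm hip _ _))// ler_wpM2r.
have /choice[phi phiP] y : exists l : R, ip (x i) y @[i --> U] --> l.
  exact: ultra_cvg_bounded UU (dot_le y).
have phi_lin : linear (phi : X -> R^o).
  move=> a u v; apply: (cvg_unique _ (phiP _)) => //.
  rewrite (_ : (fun i => _) = (fun i => a * ip (x i) u + ip (x i) v)).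
    by apply: cvgD => //; exact: cvgMl_tmp.
  by apply/funext => i; rewrite linearDr linearZr_LR.
pose F : {linear X -> R^o} :=
  HB.pack (phi : X -> R^o) (GRing.isLinear.Build _ _ _ _ _ phi_lin).
have F_cont : continuous F.
  apply/linear_bounded_continuous/linear_boundedP.
  near=> r => y; apply: (@le_trans _ _ (M * `|y|)).
    have cvg_y : `|ip (x i) y| @[i --> U] --> `|phi y| by exact: cvg_norm.
    rewrite -(cvg_lim _ cvg_y)//; apply: limr_le; first exact: cvgP cvg_y.
    by apply: nearW => i; exact: dot_le.
  by rewrite ler_wpM2r//; near: r; exact: nbhs_pinfty_ge.
have [z zP] := riesz hip F_cont.
by exists z => y; rewrite -zP; exact: phiP.
Unshelve. all: by end_near.
Qed.

(** A filter is the intersection of the ultrafilters that refine it: if [A] is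
    not in [F], then the trace of [F] on [~` A] is proper and extends to an
    ultrafilter avoiding [A]. *)
Lemma filter_of_ultra (T : Type) (F : set_system T) (A : set T) :
  Filter F -> (forall U, UltraFilter U -> F `<=` U -> U A) -> F A.
Proof.
move=> FF ultraA; apply: contrapT => nFA.
have GP : ProperFilter (within (~` A) F).
  split; last exact: within_filter.
  rewrite /within /= => FA; apply: nFA.
  by apply: filterS FA => t; exact: contrapT.
have [U [UU FU]] := ultraFilterLemma GP.
have UA : U A.
  by apply: ultraA => // B FB; apply: FU; apply: filterS FB => t Bt _.
have UnA : U (~` A) by apply: FU; exact: withinT.
by have [t []] := filter_ex (filterI UA UnA).
Qed.

(** * Demiclosedness and Opial's lemma *)

(** A form of Browder's demiclosedness principle in which the operator varies
    with the index.  A weak limit [z] is the asymptotic centre of the sequence: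
    [`|x n - w| ^+ 2 - `|x n - z| ^+ 2] tends to [`|z - w| ^+ 2].
    Nonexpansiveness makes [x n] asymptotically no farther from [w], the limit
    of the [S n z], than from [z], so this limit is at most [0]. *)
Lemma demiclosed_nonexpansive (R : realType) (X : completeNormedModType R)
    (ip : {dot X for (idfun : R -> R)}) (U : set_system nat)
    (x : nat -> X) (S : nat -> X -> X) (z w : X) (M : R) :
  induces_norm ip -> ProperFilter U -> (forall n, `|x n| <= M) ->
  (forall n, nonexpansive (S n)) ->
  x n - S n (x n) @[n --> U] --> (0 : X) -> S n z @[n --> U] --> w ->
  (forall y, ip (x n) y @[n --> U] --> ip z y) ->
  z = w.
Proof.
move=> hip UP x_le S_nonexp xS Sz xz.
(* [`|x n - w| <= e n + `|x n - z|], by passing through [S n (x n)] and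
   [S n z]. *)
pose e n := `|x n - S n (x n)| + `|S n z - w|.
have e_cvg : e n @[n --> U] --> (0 : R).
  rewrite -[X in _ --> X]addr0; apply: cvgD.
    by rewrite -(@normr0 _ X); exact: cvg_norm.
  rewrite -(@normr0 _ X) -(subrr w).
  by apply: cvg_norm; apply: cvgB => //; exact: cvg_cst.
have lhs_cvg : 2 * ip (x n) (z - w) + (`|w| ^+ 2 - `|z| ^+ 2) @[n --> U]
    --> 2 * ip z (z - w) + (`|w| ^+ 2 - `|z| ^+ 2).
  by apply: cvgD; [exact: cvgMl_tmp | exact: cvg_cst].
have rhs_cvg : e n * (e n + 2 * (M + `|z|)) @[n --> U] --> (0 : R).
  rewrite -[X in _ --> X](mul0r (0 + 2 * (M + `|z|))).
  by apply: cvgM => //; apply: cvgD => //; exact: cvg_cst.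
suff : `|z - w| ^+ 2 <= 0.
  rewrite real_exprn_even_le0 ?num_real//= normr_eq0 subr_eq0.
  by move/eqP.
have -> : `|z - w| ^+ 2 = 2 * ip z (z - w) + (`|w| ^+ 2 - `|z| ^+ 2).
  by rewrite (sqr_normB hip) linearBr /= (hip z); ring.
apply: (ler_cvg_to lhs_cvg rhs_cvg); apply: nearW => n.
have -> : 2 * ip (x n) (z - w) + (`|w| ^+ 2 - `|z| ^+ 2) =
    `|x n - w| ^+ 2 - `|x n - z| ^+ 2.
  by rewrite !(sqr_normB hip) linearBr /=; ring.
have e_ge0 : 0 <= e n by rewrite addr_ge0.
have xw_le : `|x n - w| <= e n + `|x n - z|.
  have -> : x n - w = (x n - S n (x n)) + (S n z - w) + (S n (x n) - S n z).
    by rewrite [RHS]addrAC !addrA !subrK.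
  rewrite (le_trans (ler_normD _ _))// lerD ?S_nonexp//.
  exact: ler_normD.
have xz_le : `|x n - z| <= M + `|z|.
  by rewrite (le_trans (ler_normB _ _))// lerD2r.
have : `|x n - w| ^+ 2 <= (e n + `|x n - z|) ^+ 2.
  by rewrite ler_sqr ?nnegrE ?addr_ge0.
have := ler_wpM2l e_ge0 xz_le; lra.
Qed.

Lemma Opial_bounded (R : realType) (X : normedModType R) (C : set X)
    (x : nat -> X) :
  Opial C x -> exists M, forall n, `|x n| <= M.
Proof.
move=> [[c Cc] x_cvg].
have /cvg_seq_bounded/pinfty_ex_gt0[M _ M_le] := x_cvg c Cc.
exists (M + `|c|) => n; rewrite -[x n](subrK c).
rewrite (le_trans (ler_normD _ _))// lerD2r.
by rewrite -[leLHS]normr_id; exact: M_le.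
Qed.

(** Opial's lemma.  If [z] and [w] are both in [C], then
    [`|x n - z| ^+ 2 - `|x n - w| ^+ 2], hence also [ip (x n) (w - z)], has a
    limit along the whole sequence.  When [z] and [w] are weak cluster points,
    that limit is both [ip z (w - z)] and [ip w (w - z)], so [z = w]. *)
Lemma Opial_cvg (R : realType) (X : completeNormedModType R)
    (ip : {dot X for (idfun : R -> R)}) (C : set X) (x : nat -> X) :
  induces_norm ip -> Opial C x ->
  (forall U z, UltraFilter U -> \oo `<=` U ->
     (forall y, ip (x n) y @[n --> U] --> ip z y) -> C z) ->
  exists2 z, C z & forall y, ip (x n) y @[n --> \oo] --> ip z y.
Proof.
move=> hip x_Opial cluster_C; have [_ x_cvg] := x_Opial.
have [M x_le] := Opial_bounded x_Opial.
have ultralimit U : UltraFilter U ->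
    exists z, forall y, ip (x n) y @[n --> U] --> ip z y.
  by move=> UU; exact: weak_ultralimit hip UU x_le.
have ultralimit_unique U V z w : UltraFilter U -> UltraFilter V ->
    \oo `<=` U -> \oo `<=` V ->
    (forall y, ip (x n) y @[n --> U] --> ip z y) ->
    (forall y, ip (x n) y @[n --> V] --> ip w y) -> z = w.
  move=> UU VV ooU ooV Uz Vw.
  have [lz lzP] := (cvg_ex _).1 (x_cvg z (cluster_C U z UU ooU Uz)).
  have [lw lwP] := (cvg_ex _).1 (x_cvg w (cluster_C V w VV ooV Vw)).
  (* The value forced by the polarisation identity used just below. *)
  pose l := 2^-1 * (lz * lz - lw * lw - `|z| ^+ 2 + `|w| ^+ 2).
  have l_cvg : ip (x n) (w - z) @[n --> \oo] --> l.
    have -> : (fun n => ip (x n) (w - z)) = (fun n => 2^-1 *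
        (`|x n - z| * `|x n - z| - `|x n - w| * `|x n - w|
         - `|z| ^+ 2 + `|w| ^+ 2)).
      apply/funext => n; rewrite -!expr2 !(sqr_normB hip) linearBr /=; lra.
    apply: cvgMl_tmp; apply: cvgD; last exact: cvg_cst.
    apply: cvgB; last exact: cvg_cst.
    by apply: cvgB; exact: cvgM.
  have zl : ip z (w - z) = l.
    by apply: (cvg_unique _ (Uz _)) => //;
      apply: cvg_trans l_cvg; exact: cvg_app.
  have wl : ip w (w - z) = l.
    by apply: (cvg_unique _ (Vw _)) => //;
      apply: cvg_trans l_cvg; exact: cvg_app.
  apply/esym/eqP; rewrite -subr_eq0 -normr_eq0 -sqrf_eq0 hip linearBl /=.
  by rewrite zl wl subrr.
have [U [UU ooU]] := ultraFilterLemma (F := \oo) _.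
have [z zP] := ultralimit U UU.
exists z => [|y]; first exact: cluster_C zP.
move=> B Bz; rewrite /fmap /=; apply: (@filter_of_ultra _ \oo) => V VV ooV.
have [w wP] := ultralimit V VV.
by rewrite (ultralimit_unique U V z w) // in Bz; exact: wP.
Qed.

(** Weak convergence is tested on continuous functionals; these are all inner
    products by [riesz]. *)
Lemma weakly_cvg_dot (R : realType) (X : completeNormedModType R)
    (ip : {dot X for (idfun : R -> R)}) (x : nat -> X) (z : X) :
  induces_norm ip -> (forall y, ip (x n) y @[n --> \oo] --> ip z y) ->
  weakly_cvg x z.
Proof.
move=> hip xz f f_cont; have [v fE] := riesz hip f_cont.
rewrite (_ : (fun n => _) = (fun n => ip (x n) v)); last first.
  by apply/funext => n; rewrite fE dotC.
by rewrite fE dotC; exact: xz.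
Qed.

Lemma weakly_cvg_sub0 (R : realType) (X : normedModType R) (x y : nat -> X)
    (z : X) :
  weakly_cvg x z -> x n - y n @[n --> \oo] --> (0 : X) -> weakly_cvg y z.
Proof.
move=> xz xy f f_cont.
rewrite (_ : (fun n => _) = (fun n => f (x n) - f (x n - y n))); last first.
  by apply/funext => n; rewrite linearB opprB addrC subrK.
rewrite -[f z]subr0 -[X in _ - X](linear0 f).
by apply: cvgB; [exact: xz | apply: (cvg_comp _ _ xy); exact: f_cont].
Qed.

(** * Relocated fixed-point iterations *)

(** [Q gamma gamma] is idempotent on fixed points by the composition rule, and
    an injective idempotent map is the identity. *)
Lemma relocators_id (R : realType) (X : normedModType R) (Gamma : set R)
    (T : R -> X -> X) (Q : R -> R -> X -> X) (L : R -> R -> R) (gamma : R) c :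
  relocators Gamma T Q L -> Gamma gamma -> Fix (T gamma) c ->
  Q gamma gamma c = c.
Proof.
move=> QP Gg Tc; have [Q_in Q_inj _] := relocators_bij QP Gg Gg.
by apply: Q_inj; rewrite ?inE ?(relocators_comp QP)//; exact: Q_in.
Qed.

Lemma cvg_within_seq (T U : topologicalType) (D : set T) (f : T -> U)
    (u : nat -> T) (l : T) :
  {within D, continuous f} -> D l -> (forall n, D (u n)) ->
  u n @[n --> \oo] --> l -> f (u n) @[n --> \oo] --> f l.
Proof.
move=> f_cont Dl Du ul.
have f_l := (subspace_continuousP D f).1 f_cont l Dl.
apply: cvg_trans f_l => B /ul uB.
by apply: (@filterS _ \oo _ _ _ _ uB) => n; exact.
Qed.

Theorem theorem4p5 (R : realType) (X : completeNormedModType R)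
  (ip : {dot X for (idfun : R -> R)}) (hip : induces_norm ip)
  (Gamma : set R) (Gamma0 : Gamma !=set0)
  (Gamma_gt0 : forall gamma, Gamma gamma -> 0 < gamma)
  (T : R -> X -> X)
  (T_nonexp : forall gamma, Gamma gamma -> nonexpansive (T gamma))
  (T_fix : forall gamma, Gamma gamma -> Fix (T gamma) !=set0)
  (Q : R -> R -> X -> X) (L : R -> R -> R)
  (QP : relocators Gamma T Q L)
  (g : nat -> R) (gbar : R)
  (g_Gamma : forall n, Gamma (g n)) (gbar_Gamma : Gamma gbar)
  (g_cvg : g n @[n --> \oo] --> gbar)
  (L_sum : (\sum_(0 <= n <oo) (L (g n.+1) (g n) - 1)%:E < +oo)%E)
  (x0 : X) (x : nat -> X) (x_0 : x 0%N = x0)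
  (x_S : forall n, x n.+1 = Q (g n.+1) (g n) (T (g n) (x n))) :
  [/\ Opial (Fix (T gbar)) x,
      (exists2 alpha : R, 0 < alpha < 1 &
         forall gamma, Gamma gamma -> averaged alpha (T gamma)) ->
      x n - T (g n) (x n) @[n --> \oo] --> (0 : X)
    & (exists2 alpha : R, 0 < alpha < 1 &
         forall gamma, Gamma gamma -> averaged alpha (T gamma)) ->
      {within [set: X] `*` Gamma, continuous (fun p : X * R => T p.2 p.1)} ->
      exists2 z : X, Fix (T gbar) z &
        weakly_cvg x z /\ weakly_cvg (fun n => T (g n) (x n)) z].
Proof.
have L_ge1 n : 1 <= L (g n.+1) (g n) by exact: (relocators_constant_ge1 QP).
pose e n := L (g n.+1) (g n) - 1.
have e_ge0 n : 0 <= e n by rewrite subr_ge0.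
have e_cvg : cvgn (series e) by exact: is_cvg_series_of_nneseries_lty.
pose c_ c n := Q (g n) gbar c.
have c_fix c n : Fix (T gbar) c -> Fix (T (g n)) (c_ c n).
  by move=> Tc; have [Q_in _ _] := relocators_bij QP gbar_Gamma (g_Gamma n);
    exact: Q_in.
have c_cvg c : Fix (T gbar) c -> c_ c n @[n --> \oo] --> c.
  move=> Tc; rewrite -[X in _ --> X](relocators_id QP gbar_Gamma Tc).
  exact: (cvg_within_seq (relocators_continuous QP gbar_Gamma Tc)).
have x_le c n : Fix (T gbar) c ->
    `|x n.+1 - c_ c n.+1| <= L (g n.+1) (g n) * `|T (g n) (x n) - c_ c n|.
  move=> Tc; rewrite x_S.
  rewrite -[c_ c n.+1](relocators_comp QP gbar_Gamma (g_Gamma n) _ Tc)//.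
  have Q_lip := relocators_lipschitz QP (g_Gamma n) (g_Gamma n.+1).
  exact: (Q_lip (T (g n) (x n), c_ c n)).
have a_cvg c : Fix (T gbar) c -> cvgn (fun n => `|x n - c_ c n|).
  move=> Tc; apply: (is_cvg_almost_nonincreasing e_ge0 e_cvg) => // n.
  rewrite /e subrKC (le_trans (x_le c n Tc))// ler_wpM2l//.
    exact: le_trans (L_ge1 n).
  by rewrite -[X in _ - X](c_fix c n Tc); exact: T_nonexp.
have x_Opial : Opial (Fix (T gbar)) x.
  split => [|c Tc]; first exact: T_fix.
  have [l a_l] := (cvg_ex _).1 (a_cvg c Tc).
  apply/cvg_ex; exists l.
  have ca_cvg : `|c_ c n - c| @[n --> \oo] --> (0 : R).
    rewrite -(@normr0 _ X) -(subrr c).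
    by apply: cvg_norm; apply: cvgB; [exact: c_cvg | exact: cvg_cst].
  apply: (@squeeze_cvgr _ _ _ _ (fun n => `|x n - c_ c n| - `|c_ c n - c|)
    (fun n => `|x n - c_ c n| + `|c_ c n - c|) _ _ l).
  - apply: nearW => n; rewrite ler_distD andbT lerBlDr.
    by rewrite [`|c_ c n - c|]distrC ler_distD.
  - by rewrite -[X in _ --> X]subr0; exact: cvgB.
  - by rewrite -[X in _ --> X]addr0; exact: cvgD.
have x_asymp : (exists2 alpha : R, 0 < alpha < 1 &
      forall gamma, Gamma gamma -> averaged alpha (T gamma)) ->
    x n - T (g n) (x n) @[n --> \oo] --> (0 : X).
  move=> [alpha /andP[alpha_gt0 alpha_lt1] T_avg].
  have [c Tc] := T_fix _ gbar_Gamma.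
  have [l a_l] := (cvg_ex _).1 (a_cvg c Tc).
  pose k := (1 - alpha) / alpha.
  have k_gt0 : 0 < k by rewrite divr_gt0// subr_gt0.
  (* [r n] bounds [`|T (g n) (x n) - c_ c n|] from below, since
     [Q (g n.+1) (g n)] expands distances at most by its Lipschitz constant. *)
  pose r n := `|x n.+1 - c_ c n.+1| / L (g n.+1) (g n).
  have r_cvg : r n @[n --> \oo] --> (l : R).
    rewrite -[X in _ --> X]divr1; apply: cvgM.
      by have := a_l; rewrite -cvg_shiftS.
    apply: cvgV => //.
    rewrite (_ : (fun n => _) = (fun n => e n + 1)); last first.
      by apply/funext => n; rewrite subrK.
    rewrite -[X in _ --> X]add0r; apply: cvgD; last exact: cvg_cst.
    exact: cvg_series_cvg_0.
  have d_cvg : k^-1 * (`|x n - c_ c n| * `|x n - c_ c n| - r n * r n)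
      @[n --> \oo] --> (0 : R).
    rewrite -[X in _ --> X](mulr0 k^-1) -(subrr (l * l)).
    by apply: cvgMl_tmp; apply: cvgB; exact: cvgM.
  have sqr_le n : `|x n - T (g n) (x n)| ^+ 2 <=
      k^-1 * (`|x n - c_ c n| * `|x n - c_ c n| - r n * r n).
    rewrite ler_pdivlMl// -!expr2 lerBrDl.
    apply: le_trans (T_avg _ (g_Gamma n) (x n) (c_ c n)).
    rewrite (c_fix c n Tc) subrr subr0 lerD2r.
    have L_gt0 : 0 < L (g n.+1) (g n) by exact: lt_le_trans (L_ge1 n).
    rewrite ler_sqr ?nnegrE ?divr_ge0 ?(ltW L_gt0)//.
    by rewrite ler_pdivrMr// mulrC; exact: x_le.
  have sqr_cvg : `|x n - T (g n) (x n)| ^+ 2 @[n --> \oo] --> (0 : R).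
    apply: (squeeze_cvgr _ (cvg_cst 0) d_cvg); apply: nearW => n.
    by rewrite sqr_ge0 sqr_le.
  apply/cvgr0Pnorm_lt => eps eps_gt0.
  have /cvgr0Pnorm_lt/(_ (eps ^+ 2)) := sqr_cvg.
  rewrite exprn_gt0// => /(_ isT); apply: filterS => n.
  by rewrite ger0_norm ?sqr_ge0// ltr_sqr ?nnegrE// ltW.
split=> // T_avg T_cont.
have x_T := x_asymp T_avg.
have [z Tz xz] : exists2 z, Fix (T gbar) z &
    forall y, ip (x n) y @[n --> \oo] --> ip z y.
  apply: (Opial_cvg hip x_Opial) => U z UU ooU xz.
  have [M x_bnd] := Opial_bounded x_Opial.
  apply/esym.
  apply: (demiclosed_nonexpansive (S := T \o g) hip _ x_bnd _ _ _ xz).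
  - by move=> n; exact: T_nonexp.
  - by apply: cvg_trans x_T; exact: cvg_app.
  apply: (@cvg_trans _ (T (g n) z @[n --> \oo])); first exact: cvg_app.
  apply: (cvg_within_seq (u := fun n => (z, g n)) (l := (z, gbar)) T_cont)
    => [|n|].
  - by split.
  - by split; last exact: g_Gamma.
  - by apply: (@cvg_pair _ _ _ \oo (nbhs z) (nbhs gbar)) => //; exact: cvg_cst.
exists z => //; have x_weak := weakly_cvg_dot hip xz.
by split=> //; exact: weakly_cvg_sub0 x_weak x_T.
Qed.
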